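(* Let $n\ge 1$ and let $\Phi=\mathrm{circ}(\varphi_0,\varphi_1,\dots,\varphi_{n-1})\in L^\infty(\mathcal{C}_n)$. Let $U$ be the constant $n\times n$ unitary matrix with columns $v_k=\frac{1}{\sqrt n}(1,\mu_n^{k},\mu_n^{2k},\dots,\mu_n^{(n-1)k})^T$, $k=0,\dots,n-1$, where $\mu_n=e^{2\pi i/n}$, and let $\Lambda$ be the diagonal matrix-valued function with $U^*\Phi(z)U=\Lambda(z)=\mathrm{diag}(\lambda_0(z),\lambda_1(z),\dots,\lambda_{n-1}(z))$, i.e. $\lambda_k=\sum_{j=0}^{n-1}\varphi_j\,\mu_n^{jk}$. Then: (i) $T_\Phi$ is unitarily equivalent to $T_\Lambda$; (ii) $T_\Phi$ is binormal if and only if $T_\Lambda$ is binormal.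
   Context: $\mathbb{T}$ is the unit circle with normalized Lebesgue measure; $M_n$ is the algebra of complex $n\times n$ matrices. $\mathrm{circ}(a_0,\dots,a_{n-1})$ denotes the circulant matrix with first row $(a_0,a_1,\dots,a_{n-1})$, each subsequent row being the cyclic right shift of the previous one (so the $(i,j)$ entry is $a_{(j-i)\bmod n}$); $\mathcal{C}_n\subset M_n$ is the space of $n\times n$ circulant matrices, and $L^\infty(\mathcal{C}_n)$ is the space of essentially bounded measurable functions $\mathbb{T}\to\mathcal{C}_n$. $H^2(\mathbb{C}^n)$ is the $\mathbb{C}^n$-valued Hardy space, the closed subspace of $L^2(\mathbb{T};\mathbb{C}^n)$ of functions whose Fourier coefficients of negative index vanish, and $P$ is the orthogonal projection of $L^2(\mathbb{T};\mathbb{C}^n)$ onto it. For an essentially bounded $\Phi:\mathbb{T}\to M_n$, the block Toeplitz operator is $T_\Phi f=P(\Phi f)$, $f\in H^2(\mathbb{C}^n)$. A bounded operator $T$ is binormal if $T^*T$ and $TT^*$ commute. Operators $S,T$ are unitarily equivalent if $S=V^*TV$ for some unitary operator $V$. *)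

(* Defs.v *)
From HB Require Import structures.
From mathcomp Require Import all_boot all_order all_algebra.
From mathcomp Require Import spectral sesquilinear ring_quotient generic_quotient.
From mathcomp Require Import complex.
From mathcomp Require Import all_classical all_reals all_analysis measurable_realfun.
From mathcomp Require Import ring lra.

Set Implicit Arguments.
Unset Strict Implicit.
Unset Printing Implicit Defensive.

Import Order.TTheory GRing.Theory Num.Theory.
Import numFieldNormedType.Exports.

Local Open Scope classical_set_scope.
Local Open Scope ring_scope.
Local Open Scope quotient_scope.
Local Open Scope complex_scope.

Definition circle (R : realType) := {z : R[i] | `|z| == 1}.

Section Circle.
Variable R : realType.

Lemma circle_1_subproof : `|1 : R[i]| == 1.
Proof. by rewrite normr1. Qed.

HB.instance Definition _ := Choice.on (circle R).
HB.instance Definition _ :=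
  isPointed.Build (circle R) (exist _ (1 : R[i]) circle_1_subproof).

(* The circle carries the Borel sigma-algebra induced by its embedding in the
   plane. *)
Definition circle_coord (z : circle R) : R * R :=
  (complex.Re (val z), complex.Im (val z)).

HB.instance Definition _ := Measurable.copy (circle R)
  (g_sigma_algebra_preimageType circle_coord).

Definition expi (t : R) : R[i] := cos t +i* sin t.

Lemma normr_expi (t : R) : `|expi t| == 1.
Proof. by rewrite normc_def/= cos2Dsin2 sqrtr1. Qed.

Definition circle_arc (t : R) : circle R :=
  exist _ (expi t) (normr_expi t).

Lemma measurable_circle_arc : measurable_fun [set: R] circle_arc.
Proof.
move=> _ B [C mC <-].
have mf : measurable_fun [set: R]
    (fun t : R => (cos t : R, sin t : R)).
  apply/measurable_fun_pairP; split.
  - exact: (continuous_measurable_fun (@continuous_cos R)).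
  - exact: (continuous_measurable_fun (@continuous_sin R)).
have := mf measurableT _ mC.
by rewrite !setTI.
Qed.

Lemma pi2_gt0 : 0 < 2 * pi :> R.
Proof. by rewrite mulr_gt0 ?pi_gt0. Qed.

(* Normalized arc length: the image of the uniform probability on [0, 2 pi]
   under t |-> e^(it). *)
Definition circle_measure : set (circle R) -> \bar R :=
  pushforward (uniform_prob pi2_gt0) circle_arc.

Let arcm : {measure set (circle R) -> \bar R} :=
  measure_function_pushforward__canonical__measure_function_Measure
    (uniform_prob pi2_gt0) measurable_circle_arc.

Let circle_measure0 : circle_measure set0 = 0%E.
Proof. exact: (measure0 arcm). Qed.

Let circle_measure_ge0 A : (0 <= circle_measure A)%E.
Proof. exact: (measure_ge0 arcm). Qed.

Let circle_measure_sigma_additive : semi_sigma_additive circle_measure.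
Proof. exact: (@measure_semi_sigma_additive _ _ _ arcm). Qed.

HB.instance Definition _ := isMeasure.Build _ _ _ circle_measure
  circle_measure0 circle_measure_ge0 circle_measure_sigma_additive.

Let circle_measureT : circle_measure setT = 1%E.
Proof. by rewrite /circle_measure /pushforward preimage_setT probability_setT. Qed.

HB.instance Definition _ := @Measure_isProbability.Build _ _ R
  circle_measure circle_measureT.
End Circle.


Section ComplexFunctions.
Context d (T : measurableType d) (R : realType).
Variable mu : probability T R.
Implicit Types f g h : T -> R[i].

Definition cmeasurable f :=
  measurable_fun [set: T] (fun x => complex.Re (f x)) /\
  measurable_fun [set: T] (fun x => complex.Im (f x)).

Definition cintegral f : R[i] :=
  (\int[mu]_x complex.Re (f x)) +i* (\int[mu]_x complex.Im (f x)).

Definition sqr_integrable f :=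
  cmeasurable f /\ mu.-integrable setT (fun x => (Normc.normc (f x) ^+ 2)%:E).

Lemma normc_sqr (z : R[i]) :
  Normc.normc z ^+ 2 = complex.Re z ^+ 2 + complex.Im z ^+ 2.
Proof. by case: z => a b /=; rewrite sqr_sqrtr// addr_ge0 ?sqr_ge0. Qed.

Lemma cmeasurable_cst c : cmeasurable (fun=> c).
Proof. by split; exact: measurable_cst. Qed.

Lemma cmeasurableD f g :
  cmeasurable f -> cmeasurable g -> cmeasurable (fun x => f x + g x).
Proof.
move=> [f1 f2] [g1 g2]; split.
- rewrite (_ : (fun x => _) = (fun x => complex.Re (f x) + complex.Re (g x))).
    exact: measurable_funD.
  by apply/funext => x; rewrite raddfD.
- rewrite (_ : (fun x => _) = (fun x => complex.Im (f x) + complex.Im (g x))).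
    exact: measurable_funD.
  by apply/funext => x; rewrite raddfD.
Qed.

Lemma cmeasurableM f g :
  cmeasurable f -> cmeasurable g -> cmeasurable (fun x => f x * g x).
Proof.
move=> [f1 f2] [g1 g2]; split.
- rewrite (_ : (fun x => _) = (fun x => complex.Re (f x) * complex.Re (g x) -
    complex.Im (f x) * complex.Im (g x))).
    by apply: measurable_funB; exact: measurable_funM.
  by apply/funext => x; case: (f x) (g x) => [? ?] [].
- rewrite (_ : (fun x => _) = (fun x => complex.Re (f x) * complex.Im (g x) +
    complex.Im (f x) * complex.Re (g x))).
    by apply: measurable_funD; exact: measurable_funM.
  by apply/funext => x; case: (f x) (g x) => [? ?] [].
Qed.

Lemma measurable_normc_sqr f : cmeasurable f ->
  measurable_fun [set: T] (fun x => Normc.normc (f x) ^+ 2).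
Proof.
move=> [f1 f2].
rewrite (_ : (fun x => _) = (fun x => complex.Re (f x) ^+ 2 +
  complex.Im (f x) ^+ 2)); last by apply/funext => x; rewrite normc_sqr.
by apply: measurable_funD; exact: measurable_funX.
Qed.

Lemma sqr_integrableD f g :
  sqr_integrable f -> sqr_integrable g -> sqr_integrable (fun x => f x + g x).
Proof.
move=> [mf if_] [mg ig]; have mfg := cmeasurableD mf mg; split=> //.
apply: (@le_integrable _ _ _ mu setT measurableT _
  (fun x => (2 * Normc.normc (f x) ^+ 2 +
             2 * Normc.normc (g x) ^+ 2)%:E)) => //=.
- by apply/measurable_EFinP; exact: measurable_normc_sqr.
- move=> x _; rewrite lee_fin !normc_sqr.
  case: (f x) (g x) => [a b] [a' b'] /=.
  have sq0 (u v : R) : 0 <= u ^+ 2 + v ^+ 2 by rewrite addr_ge0 ?sqr_ge0.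
  rewrite ger0_norm// ger0_norm; last by rewrite addr_ge0 ?mulr_ge0.
  rewrite -subr_ge0.
  rewrite (_ : _ - _ = (a - a') ^+ 2 + (b - b') ^+ 2); last by ring.
  exact: sq0.
- have : mu.-integrable setT ((fun x => 2%:E * (Normc.normc (f x) ^+ 2)%:E) \+
      (fun x => 2%:E * (Normc.normc (g x) ^+ 2)%:E))%E.
    by apply: integrableD => //; exact: integrableZl.
  by apply: eq_integrable => // x _; rewrite EFinD !EFinM.
Qed.

Lemma sqr_integrable_bddM (M : R) f g :
  cmeasurable g -> (\forall x \ae mu, Normc.normc (g x) <= M) ->
  sqr_integrable f -> sqr_integrable (fun x => g x * f x).
Proof.
move=> mg gM [mf if_]; have mgf := cmeasurableM mg mf; split=> //.
have mn := measurable_normc_sqr mgf.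
apply/integrableP; split; first exact/measurable_EFinP.
apply: (@le_lt_trans _ _
    (\int[mu]_x ((M ^+ 2)%:E * (Normc.normc (f x) ^+ 2)%:E))%E).
- apply: ae_ge0_le_integral => //.
  + by apply: measurableT_comp => //; exact/measurable_EFinP.
  + by move=> x _; rewrite -EFinM lee_fin mulr_ge0 ?sqr_ge0.
  + apply: emeasurable_funM => //.
    by apply/measurable_EFinP; exact: measurable_normc_sqr.
  + apply: filterS gM => x gM _ /=.
    rewrite lee_fin ger0_norm ?sqr_ge0// Normc.normcM exprMn ler_wpM2r ?sqr_ge0//.
    by rewrite lerXn2r// nnegrE; [case: (g x) => * /=; exact: sqrtr_ge0
      |apply: le_trans gM; case: (g x) => * /=; exact: sqrtr_ge0].
- have /integrableP[_] := integrableZl measurableT (M ^+ 2) if_.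
  apply: le_lt_trans; apply: ge0_le_integral => //.
  + by move=> x _; rewrite -EFinM lee_fin mulr_ge0 ?sqr_ge0.
  + by apply: emeasurable_funM => //;
      apply/measurable_EFinP; exact: measurable_normc_sqr.
  + apply: measurableT_comp => //.
    by apply: emeasurable_funM => //;
      apply/measurable_EFinP; exact: measurable_normc_sqr.
  + by move=> x _; exact: lee_abs.
Qed.

Lemma sqr_integrable_cst0 : sqr_integrable (fun=> 0).
Proof.
split; first exact: cmeasurable_cst.
under eq_fun do rewrite Normc.normc0 expr0n/=.
exact: integrable0.
Qed.

Lemma sqr_integrable_sum (I : Type) (s : seq I) (F : I -> T -> R[i]) :
  (forall i, sqr_integrable (F i)) ->
  sqr_integrable (fun x => \sum_(i <- s) F i x).
Proof.
move=> FP; elim: s => [|i s IH].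
  by under eq_fun do rewrite big_nil; exact: sqr_integrable_cst0.
by under eq_fun do rewrite big_cons; exact: sqr_integrableD.
Qed.

End ComplexFunctions.


Section Integral.
Context d (T : measurableType d) (R : realType).
Variable mu : probability T R.
Implicit Types f g h : T -> R[i].

Definition cintegrable f :=
  mu.-integrable setT (fun x => (complex.Re (f x))%:E) /\
  mu.-integrable setT (fun x => (complex.Im (f x))%:E).

Lemma sqr_integrable_cintegrable f : sqr_integrable mu f -> cintegrable f.
Proof.
move=> [[mr mi] if_].
have i1 : mu.-integrable setT (fun x => (1 + Normc.normc (f x) ^+ 2)%:E).
  have i0 : mu.-integrable setT (fun=> 1%:E : \bar R).
    exact: finite_measure_integrable_cst.
  by move: (integrableD measurableT i0 if_); apply: eq_integrable.
have ab (a b : R) : `|a| <= `|1 + (a ^+ 2 + b ^+ 2)|.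
  have b2 := sqr_ge0 b; have a2 := sqr_ge0 a.
  have p := sqr_ge0 (1 - `|a|).
  rewrite sqrrB expr1n mul1r real_normK ?num_real// in p.
  rewrite [leRHS]ger0_norm; last by lra.
  by have := normr_ge0 a; lra.
split; apply: (le_integrable measurableT _ _ i1).
- exact/measurable_EFinP.
- by move=> x _; rewrite lee_fin normc_sqr; exact: ab.
- exact/measurable_EFinP.
- by move=> x _; rewrite lee_fin normc_sqr [_ ^+ 2 + _]addrC; exact: ab.
Qed.

Lemma cintegralD f g : cintegrable f -> cintegrable g ->
  cintegral mu (fun x => f x + g x) = cintegral mu f + cintegral mu g.
Proof.
move=> [f1 f2] [g1 g2]; rewrite /cintegral.
under eq_Rintegral do rewrite raddfD/=.
rewrite RintegralD//.
under [X in _ +i* X]eq_Rintegral do rewrite raddfD/=.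
by rewrite RintegralD.
Qed.

Lemma cintegralZl c f : cintegrable f ->
  cintegral mu (fun x => c * f x) = c * cintegral mu f.
Proof.
move=> [f1 f2]; case: c => a b; rewrite /cintegral.
have fE x : (a +i* b) * f x =
    (a * complex.Re (f x) - b * complex.Im (f x)) +i*
    (a * complex.Im (f x) + b * complex.Re (f x)) by case: (f x).
under eq_Rintegral do rewrite fE/=.
under [X in _ +i* X]eq_Rintegral do rewrite fE/=.
have iZ (k : R) (h : T -> R) : mu.-integrable setT (EFin \o h) ->
    mu.-integrable setT (EFin \o (fun x => k * h x)).
  by move=> ih; move: (integrableZl measurableT k ih); apply: eq_integrable.
rewrite RintegralB ?RintegralD//; try exact: iZ.
by rewrite !RintegralZl.
Qed.

Lemma eq_ae_cintegral f g : cmeasurable f -> cmeasurable g ->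
  (\forall x \ae mu, f x = g x) -> cintegral mu f = cintegral mu g.
Proof.
move=> [f1 f2] [g1 g2] fg; rewrite /cintegral /Rintegral.
congr (fine _ +i* fine _); apply: ae_eq_integral => //;
  try exact/measurable_EFinP.
- by apply: filterS fg => x ->.
- by apply: filterS fg => x ->.
Qed.

End Integral.


Section L2.
Variables (R : realType) (n : nat).
Local Notation m := (@circle_measure R).
Implicit Types f g : circle R -> 'cV[R[i]]_n.

Definition cV_sqnorm (v : 'cV[R[i]]_n) : R := \sum_(i < n) Normc.normc (v i 0) ^+ 2.

Definition cV_dot (v w : 'cV[R[i]]_n) : R[i] := \sum_(i < n) v i 0 * (w i 0)^*.

Definition inL2 f :=
  (forall i, cmeasurable (fun z => f z i 0)) /\
  (\int[m]_z (cV_sqnorm (f z))%:E < +oo)%E.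

Lemma inL2P f : inL2 f <-> forall i, sqr_integrable m (fun z => f z i 0).
Proof.
have fge0 i z : (0 <= (Normc.normc (f z i 0) ^+ 2)%:E)%E by rewrite lee_fin sqr_ge0.
have sumE : (forall i, cmeasurable (fun z => f z i 0)) ->
    (\int[m]_z (cV_sqnorm (f z))%:E =
     \sum_(i < n) \int[m]_z (Normc.normc (f z i 0) ^+ 2)%:E)%E.
  move=> mf; under eq_integral do rewrite /cV_sqnorm -sumEFin.
  rewrite ge0_integral_sum// => i.
  by apply/measurable_EFinP; exact: measurable_normc_sqr.
have absE i : (\int[m]_z `|(Normc.normc (f z i 0) ^+ 2)%:E| =
    \int[m]_z (Normc.normc (f z i 0) ^+ 2)%:E)%E.
  by apply: eq_integral => z _; rewrite gee0_abs.
split=> [[mf]|fP].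
  rewrite sumE// => lty i; split=> //; apply/integrableP; split.
    by apply/measurable_EFinP; exact: measurable_normc_sqr.
  rewrite absE; apply: le_lt_trans lty; rewrite (bigD1 i)//= leeDl//.
  by apply: sume_ge0 => j _; exact: integral_ge0.
have mf i : cmeasurable (fun z => f z i 0) by case: (fP i).
split=> //; rewrite sumE//; apply: lte_sum_pinfty => i _.
by have [_ /integrableP[_]] := fP i; rewrite absE.
Qed.

Definition L2pred : {pred circle R -> 'cV[R[i]]_n} := [pred f | `[< inL2 f >]].

Lemma L2pred_submod_closed : submod_closed L2pred.
Proof.
split=> [|a f g /asboolP/inL2P fP /asboolP/inL2P gP]; apply/asboolP/inL2P => i.
- by under eq_fun do rewrite mxE; exact: sqr_integrable_cst0.
- under eq_fun do rewrite !mxE; apply: sqr_integrableD => //.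
  apply: (@sqr_integrable_bddM _ _ _ _ (Normc.normc a) _ (fun=> a)) => //.
  exact: nearW.
Qed.

HB.instance Definition _ :=
  GRing.isSubmodClosed.Build _ _ L2pred L2pred_submod_closed.

Record L2fun := MkL2fun {
  L2val :> circle R -> 'cV[R[i]]_n ; L2val_in : L2val \in L2pred }.

HB.instance Definition _ := [isSub for L2val].
HB.instance Definition _ := [Choice of L2fun by <:].
HB.instance Definition _ := [SubChoice_isSubLmodule of L2fun by <:].

Definition L2null : {pred L2fun} :=
  [pred f : L2fun | `[< \forall z \ae m, f z = 0 >]].

Lemma L2null_zmod_closed : zmod_closed L2null.
Proof.
split=> [|f g /asboolP f0 /asboolP g0]; apply/asboolP.
  exact: nearW.
by apply: filterS2 f0 g0 => z fz gz; rewrite /= -[LHS]/(f z - g z) fz gz subr0.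
Qed.

HB.instance Definition _ := GRing.isZmodClosed.Build _ L2null L2null_zmod_closed.

(* Elements of L^2(T; C^n) are classes of functions modulo almost everywhere
   equality; [L2rep] picks an arbitrary representative. The integrals below do
   not depend on that choice. *)
Definition L2 := Quotient.quot L2null.
HB.instance Definition _ := GRing.Zmodule.on L2.
HB.instance Definition _ := EqQuotient.on L2.

Definition L2class (f : L2fun) : L2 := \pi_L2 f.

Definition L2rep (F : L2) : L2fun := repr F.

Lemma L2classP (f g : L2fun) :
  reflect (\forall z \ae m, f z = g z) (L2class f == L2class g).
Proof.
rewrite /L2class -Quotient.idealrBE.
apply: (iffP (asboolP _)); apply: filterS => z.
  by move=> fg; exact/subr0_eq/fg.
by move=> fg; have : f z - g z = 0 by rewrite fg subrr.
Qed.

Lemma L2repK F : L2class (L2rep F) = F.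
Proof. exact: reprK. Qed.

Lemma L2classK (f : L2fun) : \forall z \ae m, L2rep (L2class f) z = f z.
Proof. by apply/L2classP; rewrite L2repK. Qed.

Definition L2scale (a : R[i]) (F : L2) : L2 := L2class (a *: L2rep F).

Lemma L2class_scale a (f : L2fun) : L2class (a *: f) = L2scale a (L2class f).
Proof.
apply/esym/eqP/L2classP; apply: filterS (L2classK f) => z fz.
by rewrite -[LHS]/(a *: L2rep _ z) fz.
Qed.

Lemma L2class_add (f g : L2fun) : L2class (f + g) = L2class f + L2class g.
Proof. exact: (Quotient.pi_add L2null f g). Qed.

Lemma L2scaleA a b F : L2scale a (L2scale b F) = L2scale (a * b) F.
Proof. by rewrite -[F]L2repK -!L2class_scale scalerA. Qed.

Lemma L2scale1 : left_id 1 L2scale.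
Proof. by move=> F; rewrite -[F]L2repK -L2class_scale scale1r. Qed.

Lemma L2scaleDr : right_distributive L2scale +%R.
Proof.
move=> a F G; rewrite -[F]L2repK -[G]L2repK.
by rewrite -L2class_add -!L2class_scale -L2class_add scalerDr.
Qed.

Lemma L2scaleDl F : {morph L2scale^~ F : a b / a + b}.
Proof.
by move=> a b; rewrite -[F]L2repK -!L2class_scale -L2class_add scalerDl.
Qed.

HB.instance Definition _ := GRing.Zmodule_isLmodule.Build R[i] L2
  L2scaleA L2scale1 L2scaleDr L2scaleDl.

Definition L2dot (F G : L2) : R[i] :=
  cintegral m (fun z => cV_dot (L2rep F z) (L2rep G z)).

Definition fourier_coef (F : L2) (k : int) : 'cV[R[i]]_n :=
  \col_i cintegral m (fun z => L2rep F z i 0 * (val z) ^ (- k)).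

Lemma normc_circle (z : circle R) : Normc.normc (val z) = 1.
Proof. by case: z => z /= /eqP; rewrite normc_def => -[]; case: z. Qed.

Lemma measurable_circle_coord : measurable_fun [set: circle R] (@circle_coord R).
Proof. by move=> _ B mB; exists B. Qed.

Lemma cmeasurable_circleX k : cmeasurable (fun z : circle R => val z ^+ k).
Proof.
elim: k => [|k IH]; first exact: cmeasurable_cst.
under eq_fun do rewrite exprS; apply: cmeasurableM => //.
by have /measurable_fun_pairP[] := measurable_circle_coord.
Qed.

Lemma sqr_integrable_L2fun (f : L2fun) i : sqr_integrable m (fun z => f z i 0).
Proof. by move: i; apply/inL2P; case: f => f /= /asboolP. Qed.

Lemma fourier_coef_linear (k : int) a (F G : L2) : k < 0 ->
  fourier_coef (a *: F + G) k = a *: fourier_coef F k + fourier_coef G k.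
Proof.
case: k => // k _; apply/colP => i; rewrite !mxE NegzE opprK /=.
have ci (f : L2fun) : sqr_integrable m (fun z => f z i 0 * val z ^ k.+1).
  under eq_fun do rewrite mulrC; apply: (@sqr_integrable_bddM _ _ _ _ 1).
  - exact: cmeasurable_circleX.
  - apply: nearW => z; elim: k.+1 => [|j IH]; first by rewrite expr0z Normc.normc1.
    by rewrite exprSz Normc.normcM normc_circle mul1r.
  - exact: sqr_integrable_L2fun.
have ci' (f : L2fun) := sqr_integrable_cintegrable (ci f).
have cZ : cintegrable m (fun z => a * (L2rep F z i 0 * val z ^ k.+1)).
  have := ci' (a *: L2rep F); congr (cintegrable _ _); apply/funext => z.
  by rewrite -[(a *: L2rep F) z]/(a *: L2rep F z) mxE mulrA.
rewrite -(cintegralZl _ (ci' (L2rep F))) -(cintegralD cZ (ci' (L2rep G))).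
have -> : a *: F + G = L2class (a *: L2rep F + L2rep G).
  by rewrite L2class_add L2class_scale !L2repK.
apply: eq_ae_cintegral.
- by case: (ci (L2rep (L2class (a *: L2rep F + L2rep G)))).
- apply: cmeasurableD; last by case: (ci (L2rep G)).
  by apply: cmeasurableM; [exact: cmeasurable_cst|case: (ci (L2rep F))].
- apply: filterS (L2classK (a *: L2rep F + L2rep G)) => z ->.
  by rewrite -[in LHS]/(a *: L2rep F z + L2rep G z) !mxE mulrDl mulrA.
Qed.

Definition H2pred : {pred L2} :=
  [pred F | `[< forall k : int, k < 0 -> fourier_coef F k = 0 >]].

Lemma H2pred_submod_closed : submod_closed H2pred.
Proof.
have F0 k : k < 0 -> fourier_coef 0 k = 0.
  move=> k0; have := fourier_coef_linear 1 0 0 k0.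
  by rewrite !scale1r addr0 => h; apply/(addrI (fourier_coef 0 k)); rewrite addr0.
split=> [|a F G /asboolP FP /asboolP GP]; apply/asboolP => k k0; first exact: F0.
by rewrite fourier_coef_linear// FP// GP// scaler0 addr0.
Qed.

HB.instance Definition _ :=
  GRing.isSubmodClosed.Build _ _ H2pred H2pred_submod_closed.

Record H2 := MkH2 { H2val :> L2 ; H2val_in : H2val \in H2pred }.

HB.instance Definition _ := [isSub for H2val].
HB.instance Definition _ := [Choice of H2 by <:].
HB.instance Definition _ := [SubChoice_isSubLmodule of H2 by <:].

Definition H2dot (f g : H2) : R[i] := L2dot f g.

(* Orthogonal projection onto H^2: the element g of H^2 with F - g orthogonal to
   H^2. It exists and is unique since H^2 is a closed subspace of a Hilbert
   space, so the default value 0 of [xget] is never used. *)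
Definition hardy_proj (F : L2) : H2 :=
  xget 0 [set g : H2 | forall h : H2, L2dot (F - H2val g) h = 0].

(* All norms on M_n are equivalent; the bound is put on the entries. *)
Definition Linfty (Phi : circle R -> 'M[R[i]]_n) :=
  (forall i j, cmeasurable (fun z => Phi z i j)) /\
  exists M : R, \forall z \ae m, forall i j, Normc.normc (Phi z i j) <= M.

Lemma inL2_mul Phi f : Linfty Phi -> inL2 f -> inL2 (fun z => Phi z *m f z).
Proof.
move=> [mPhi [M PhiM]] /inL2P fL2; apply/inL2P => i.
under eq_fun do rewrite mxE; apply: sqr_integrable_sum => j.
apply: (@sqr_integrable_bddM _ _ _ _ M) => //.
by apply: filterS PhiM => z.
Qed.

(* For essentially bounded Phi the product is square integrable, so the default
   value 0 of [insubd] is not used: see [inL2_mul] and [L2mulE]. *)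
Definition L2mul (Phi : circle R -> 'M[R[i]]_n) (F : L2) : L2 :=
  L2class (insubd (0 : L2fun) (fun z => Phi z *m L2rep F z)).

Lemma L2mulE Phi F : Linfty Phi ->
  \forall z \ae m, L2rep (L2mul Phi F) z = Phi z *m L2rep F z.
Proof.
move=> PhiP.
apply: filterS (L2classK (insubd (0 : L2fun) (fun z => Phi z *m L2rep F z))).
move=> z ->.
suff fP : (fun y => Phi y *m L2rep F y) \in L2pred.
  exact: (congr1 (fun g : circle R -> 'cV[R[i]]_n => g z)
    (insubdK (0 : L2fun) fP)).
by apply/asboolP/inL2_mul => //; case: (L2rep F) => f /= /asboolP.
Qed.

Definition toeplitz (Phi : circle R -> 'M[R[i]]_n) (f : H2) : H2 :=
  hardy_proj (L2mul Phi f).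
End L2.

Section Operators.
Variables (R : realType) (H : lmodType R[i]) (dot : H -> H -> R[i]).
Implicit Types S T V : H -> H.

Definition ip_norm (f : H) : R := Num.sqrt (complex.Re (dot f f)).

Definition bounded_operator T :=
  linear T /\ exists M : R, forall f, ip_norm (T f) <= M * ip_norm f.

(* A bounded operator on a Hilbert space has exactly one adjoint, so quantifying
   existentially over it below amounts to naming it. *)
Definition is_adjoint T Tadj := forall f g, dot (T f) g = dot f (Tadj g).

Definition binormal T := bounded_operator T /\
  exists2 Tadj, is_adjoint T Tadj &
    (Tadj \o T) \o (T \o Tadj) =1 (T \o Tadj) \o (Tadj \o T).

Definition unitary_operator V Vadj :=
  [/\ bounded_operator V, is_adjoint V Vadj, Vadj \o V =1 id & V \o Vadj =1 id].

Definition unitarily_equivalent S T :=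
  exists V Vadj, unitary_operator V Vadj /\ S =1 Vadj \o T \o V.
End Operators.

Section Circulant.
Variables (R : realType) (n : nat).

Lemma circ_index_subproof (i j : 'I_n) : ((j + (n - i)) %% n < n)%N.
Proof. by rewrite ltn_mod (leq_ltn_trans _ (ltn_ord i)). Qed.

(* The (i, j) entry is a_((j - i) mod n); n - i stands for -i modulo n. *)
Definition circ (a : 'I_n -> R[i]) : 'M[R[i]]_n :=
  \matrix_(i, j) a (Ordinal (circ_index_subproof i j)).

Definition mu_root : R[i] := expi (2 * pi / n%:R).

Definition dft_mx : 'M[R[i]]_n :=
  \matrix_(i, k) ((sqrtC n%:R)^-1 * mu_root ^+ (i * k)).
End Circulant.

Arguments mu_root R n : clear implicits.
Arguments dft_mx R n : clear implicits.

(* Main.v *)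
Require Import Defs.
From mathcomp Require Import all_boot all_order all_algebra.
From mathcomp Require Import spectral sesquilinear complex.
From mathcomp Require Import all_classical all_reals all_analysis measurable_realfun.
From mathcomp Require Import ring lra.

Set Implicit Arguments.
Unset Strict Implicit.
Unset Printing Implicit Defensive.

Import Order.TTheory GRing.Theory Num.Theory.

Local Open Scope ring_scope.
Local Open Scope sesquilinear_scope.

(** The discrete Fourier matrix U diagonalizes every circulant: its columns are
    common eigenvectors of all circulants ([circ_eigenvector]), and they are
    orthonormal because mu_n is a primitive n-th root of unity
    ([dft_mx_unitary]). So Phi = U Lambda U^* pointwise, with a U that does
    not depend on z.

    A constant matrix A acts on L^2(T; C^n) by multiplication, with adjoint
    A^*, and it multiplies each Fourier coefficient by A; hence it maps the
    Hardy space H^2 into itself ([H2_mul_cst]). If A is unitary, this action is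
    a unitary operator of H^2 that commutes with the projection P
    ([hardy_proj_mul]). Writing V for the action of U^*, one gets
      T_Phi f = P (U Lambda U^* f) = U P (Lambda U^* f) = V^* T_Lambda V f,
    which is the unitary equivalence ([toeplitz_unitarily_equivalent]).

    Commutation of P with A follows from the characterization of P F as the
    element g of H^2 with F - g orthogonal to H^2: multiplication by A carries
    such a g for F to one for A F, and there is at most one because the inner
    product is definite. If F has no such g, then neither has A F, since A^* A F
    is F again, and the projection takes its default value 0 at both.

    Finally, conjugation by a unitary V preserves linearity and bounds and
    carries adjoints to adjoints, hence preserves binormality; unitary
    equivalence being symmetric, this gives both implications of (ii). *)

(** * Unitary equivalence in an inner product space *)

Section UnitaryTransport.
Variables (R : realType) (H : lmodType R[i]) (dot : H -> H -> R[i]).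
Implicit Types S T V W : H -> H.

Lemma unitary_operator_isometry V W : unitary_operator dot V W ->
  forall f g, dot (V f) (V g) = dot f g.
Proof. by move=> [_ adj WV _] f g; rewrite adj [W (V g)]WV. Qed.

Lemma unitary_operator_sym V W :
  unitary_operator dot V W -> unitary_operator dot W V.
Proof.
move=> uV; have iso := unitary_operator_isometry uV.
case: uV => -[linV _] _ WV VW; split=> //.
- split=> [a f g|].
    by rewrite -[f in LHS]VW -[g in LHS]VW /= -linV [LHS]WV.
  by exists 1 => f; rewrite mul1r /ip_norm -iso [V (W f)]VW.
- by move=> f g; rewrite -iso [V (W f)]VW.
Qed.

(** From S = V^* T V follows V S V^* = T, and V^* is again unitary. *)
Lemma unitarily_equivalent_sym S T :
  unitarily_equivalent dot S T -> unitarily_equivalent dot T S.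
Proof.
move=> [V [W [uV SE]]]; exists W, V; split; first exact: unitary_operator_sym.
case: uV => _ _ _ VW f /=.
by rewrite [S _]SE /= [V (W f)]VW [V (W _)]VW.
Qed.

(** For S = V^* T V the adjoint of S is V^* T^* V; the inner factors V V^*
    cancel, so S^* S and S S^* are the conjugates of T^* T and T T^*. *)
Lemma binormal_unitarily_equivalent S T :
  unitarily_equivalent dot S T -> binormal dot T -> binormal dot S.
Proof.
move=> [V [W [uV SE]]] [[linT [M boundT]] [Tadj adjT comT]].
have iso := unitary_operator_isometry uV.
have [[linW _] adjW _ _] := unitary_operator_sym uV.
case: (uV) => -[linV _] adjV WV VW.
split; first split.
- by move=> a f g; rewrite !SE /= linV linT linW.
- exists M => f; rewrite SE /=.
  have normV h : ip_norm dot (V h) = ip_norm dot h by rewrite /ip_norm iso.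
  by rewrite -normV [V (W _)]VW -[ip_norm dot f]normV.
exists (W \o Tadj \o V) => [f g|f /=].
  by rewrite SE /= adjW adjT adjV.
have VWE h : V (W h) = h by exact: VW.
by rewrite !SE /= !VWE; congr W; exact: comT.
Qed.

End UnitaryTransport.

(** * Diagonalization of circulant matrices by the discrete Fourier transform *)

Section Fourier.
Variable R : realType.

Lemma expiD (s t : R) : expi (s + t) = expi s * expi t.
Proof. by rewrite /expi cosD sinD; congr (_ +i* _)%C; rewrite addrC. Qed.

Lemma expiMn (t : R) k : expi t ^+ k = expi (t *+ k).
Proof.
elim: k => [|k IH]; first by rewrite mulr0n /expi cos0 sin0.
by rewrite exprS IH mulrS expiD.
Qed.

(** If cos t = 1, then cos (t / 2) ^ 2 = 1 and so sin (t / 2) = 0; but t / 2 lies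
    strictly between 0 and pi, where the sine is positive. *)
Lemma expi_neq1 (t : R) : 0 < t < pi *+ 2 -> expi t != 1.
Proof.
move=> /andP[t0 t2]; apply/eqP => -[ct _].
have hE : t = (t / 2) *+ 2 by rewrite mulr2n -splitr.
have s0 : 0 < sin (t / 2).
  apply: sin_gt0_pi; rewrite divr_gt0//= ltr_pdivrMr// mulr_natr//.
have := ct; rewrite hE cos_mulr2n.
have := cos2Dsin2 (t / 2); have := exprn_gt0 2 s0; lra.
Qed.

Variable n : nat.
Hypothesis n_gt0 : (0 < n)%N.

Lemma mu_root_prim : n.-primitive_root (mu_root R n).
Proof.
have n0 : 0 < n%:R :> R by rewrite ltr0n.
have muX k : mu_root R n ^+ k = expi (pi *+ 2 * (k%:R / n%:R)).
  by rewrite expiMn; congr expi; rewrite -mulr_natr; ring.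
apply/andP; split=> //; apply/forallP => i; apply/eqP; rewrite unity_rootE muX.
case: (eqVneq i.+1 n) => [->|iNn].
  have -> : n%:R / n%:R = 1 :> R by rewrite divff// gt_eqF.
  by rewrite mulr1 /expi cos2pi sin_mulr2n sinpi mulr0 mul0rn eqxx.
apply/negbTE/expi_neq1.
have i_lt : (i.+1 < n)%N by rewrite ltn_neqAle iNn ltn_ord.
have p0 : 0 < pi *+ 2 :> R by rewrite mulrn_wgt0// pi_gt0.
apply/andP; split; first by rewrite mulr_gt0// divr_gt0// ltr0n.
by rewrite gtr_pMr// ltr_pdivrMr// mul1r ltr_nat.
Qed.

Lemma mu_root_conj : (mu_root R n)^* * mu_root R n = 1.
Proof. by rewrite mulrC -normCK (eqP (normr_expi _)) expr1n. Qed.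

(** The columns are orthonormal: the inner product of two distinct ones is,
    up to the factor 1 / n, a vanishing geometric sum of powers of an n-th root
    of unity w different from 1. *)
Lemma dft_mx_unitary : dft_mx R n ^t* *m dft_mx R n = 1%:M.
Proof.
have prim := mu_root_prim; set s := (sqrtC (n%:R : R[i]))^-1.
have n0 : n%:R != 0 :> R[i] by rewrite pnatr_eq0 -lt0n.
have s2 : s^* * s = n%:R^-1.
  rewrite (CrealP _); last by rewrite ger0_real// invr_ge0 sqrtC_ge0 ler0n.
  by rewrite -expr2 exprVn sqrtCK.
apply/matrixP => k l; rewrite !mxE.
(* w is the power of mu_n with exponent l - k. *)
pose w := ((mu_root R n)^* ^+ k * mu_root R n ^+ l).
transitivity (n%:R^-1 * \sum_(i < n) w ^+ i).
  rewrite mulr_sumr; apply: eq_bigr => i _; rewrite !mxE -/s.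
  rewrite rmorphM rmorphXn /= mulrACA s2 exprMn -!exprM.
  by rewrite ![(i * _)%N]mulnC.
have wk : mu_root R n ^+ k * w = mu_root R n ^+ l.
  by rewrite mulrA -exprMn mulrC [X in X ^+ k]mulrC mu_root_conj expr1n mulr1.
have [kl|kl] := eqVneq k l.
  have -> : w = 1 by rewrite /w -kl -exprMn mu_root_conj expr1n.
  under eq_bigr do rewrite expr1n.
  by rewrite sumr_const card_ord mulVf.
have w1 : w != 1.
  apply: contraNneq kl => w1; move: wk; rewrite w1 mulr1 => /eqP.
  by rewrite (eq_prim_root_expr prim) !modn_small.
have wn : w ^+ n = 1.
  have mun := prim_expr_order prim.
  by rewrite exprMn !(exprAC _ _ n) -rmorphXn /= mun rmorph1 !expr1n mulr1.
have := subrX1 w n; rewrite wn subrr => /esym/eqP.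
by rewrite mulf_eq0 subr_eq0 (negbTE w1) /= => /eqP ->; rewrite mulr0.
Qed.

(** Entry (i, j) of the circulant depends only on j - i, and the powers of an
    n-th root of unity depend only on the exponent modulo n; substituting
    j - i for j turns the row sum into a multiple of [w ^+ i]. *)
Lemma circ_eigenvector (a : 'I_n -> R[i]) (w : R[i]) (i : 'I_n) : w ^+ n = 1 ->
  \sum_j circ a i j * w ^+ j = w ^+ i * \sum_j a j * w ^+ j.
Proof.
move=> wn.
(* [h j] is j - i modulo n. *)
pose h (j : 'I_n) := Ordinal (circ_index_subproof i j).
have h_inj : injective h.
  move=> j j' /(congr1 val) /= /eqP; rewrite eqn_modDr !modn_small//.
  by move/eqP/val_inj.
rewrite mulr_sumr [RHS](reindex_inj h_inj) /=.
apply: eq_bigr => j _; rewrite mxE -/(h j) mulrCA; congr (_ * _).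
by rewrite (expr_mod _ wn) -exprD addnCA subnKC 1?ltnW// exprD wn mulr1.
Qed.

Lemma circ_dft_diag (a : 'I_n -> R[i]) :
  dft_mx R n ^t* *m circ a *m dft_mx R n =
  diag_mx (\row_k \sum_(j < n) a j * mu_root R n ^+ (j * k)).
Proof.
set D := diag_mx _.
suff -> : circ a = dft_mx R n *m D *m dft_mx R n ^t*.
  by rewrite !mulmxA dft_mx_unitary mul1mx -mulmxA dft_mx_unitary mulmx1.
suff E : circ a *m dft_mx R n = dft_mx R n *m D.
  by rewrite -E -mulmxA (mulmx1C dft_mx_unitary) mulmx1.
apply/matrixP => i k; rewrite mul_mx_diag !mxE.
under eq_bigr do rewrite !mxE mulrCA mulnC exprM.
rewrite -mulr_sumr -mulrA; congr (_ * _).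
transitivity (\sum_j circ a i j * (mu_root R n ^+ k) ^+ j).
  by apply: eq_bigr => j _; rewrite mxE.
rewrite circ_eigenvector; last first.
  by rewrite exprAC (prim_expr_order mu_root_prim) expr1n.
rewrite -exprM mulnC; congr (_ * _); apply: eq_bigr => j _.
by rewrite -exprM mulnC.
Qed.

End Fourier.

(** * Complex integrals *)

Section ComplexIntegral.
Context d (T : measurableType d) (R : realType).
Variable mu : probability T R.
Implicit Types f g : T -> R[i].

Lemma cintegrableD f g : cintegrable mu f -> cintegrable mu g ->
  cintegrable mu (fun x => f x + g x).
Proof.
move=> [f1 f2] [g1 g2]; split.
- move: (integrableD measurableT f1 g1); apply: eq_integrable => // x _.
  by rewrite raddfD.
- move: (integrableD measurableT f2 g2); apply: eq_integrable => // x _.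
  by rewrite raddfD.
Qed.

Lemma cintegrableZl c f : cintegrable mu f ->
  cintegrable mu (fun x => c * f x).
Proof.
case: c => a b [f1 f2].
have iZ k (h : T -> \bar R) : mu.-integrable setT h ->
    mu.-integrable setT (fun x => k%:E * h x)%E by exact: integrableZl.
split.
- move: (integrableB measurableT (iZ a _ f1) (iZ b _ f2)).
  by apply: eq_integrable => // x _; case: (f x).
- move: (integrableD measurableT (iZ a _ f2) (iZ b _ f1)).
  by apply: eq_integrable => // x _; case: (f x).
Qed.

Lemma cintegrable_sum (I : Type) (s : seq I) (F : I -> T -> R[i]) :
  (forall i, cintegrable mu (F i)) ->
  cintegrable mu (fun x => \sum_(i <- s) F i x).
Proof.
move=> FP; elim: s => [|i s IH].
  under eq_fun do rewrite big_nil.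
  by split; exact: integrable0.
by under eq_fun do rewrite big_cons; exact: cintegrableD.
Qed.

Lemma cintegral_sum (I : Type) (s : seq I) (F : I -> T -> R[i]) :
  (forall i, cintegrable mu (F i)) ->
  cintegral mu (fun x => \sum_(i <- s) F i x) =
  \sum_(i <- s) cintegral mu (F i).
Proof.
move=> FP; elim: s => [|i s IH].
  under eq_fun do rewrite big_nil.
  by rewrite big_nil /cintegral !Rintegral_cst// !mul0r.
under eq_fun do rewrite big_cons.
by rewrite big_cons -IH cintegralD//; exact: cintegrable_sum.
Qed.

Lemma cmeasurable_sum (I : Type) (s : seq I) (F : I -> T -> R[i]) :
  (forall i, cmeasurable (F i)) ->
  cmeasurable (fun x => \sum_(i <- s) F i x).
Proof.
move=> FP; elim: s => [|i s IH].
  by under eq_fun do rewrite big_nil; exact: cmeasurable_cst.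
by under eq_fun do rewrite big_cons; exact: cmeasurableD.
Qed.

Lemma cmeasurable_conj f : cmeasurable f -> cmeasurable (fun x => (f x)^*).
Proof.
move=> [f1 f2]; split.
- rewrite (_ : (fun x => _) = (fun x => complex.Re (f x)))//.
  by apply/funext => x; case: (f x).
- rewrite (_ : (fun x => _) = (fun x => - complex.Im (f x))).
    exact: measurable_funN.
  by apply/funext => x; case: (f x).
Qed.

(** Both the real and the imaginary part of f g^* are at most |f|^2 + |g|^2 in
    absolute value. *)
Lemma cintegrable_mul_conj f g : sqr_integrable mu f -> sqr_integrable mu g ->
  cintegrable mu (fun x => f x * (g x)^*).
Proof.
move=> [mf if_] [mg ig].
have [m1 m2] := cmeasurableM mf (cmeasurable_conj mg).
(* a + b i and c + e i stand for f x and g x; the minus signs before e come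
   from the conjugation. *)
have bound (a b c e : R) :
    `|a * c - b * - e| <= a ^+ 2 + b ^+ 2 + (c ^+ 2 + e ^+ 2) /\
    `|a * - e + b * c| <= a ^+ 2 + b ^+ 2 + (c ^+ 2 + e ^+ 2).
  have h1 := sqr_ge0 (a + c); have h2 := sqr_ge0 (a - c).
  have h3 := sqr_ge0 (b + e); have h4 := sqr_ge0 (b - e).
  have h5 := sqr_ge0 (a + e); have h6 := sqr_ge0 (a - e).
  have h7 := sqr_ge0 (b + c); have h8 := sqr_ge0 (b - c).
  have h9 := sqr_ge0 a; have h10 := sqr_ge0 b.
  have h11 := sqr_ge0 c; have h12 := sqr_ge0 e.
  by split; rewrite ler_norml; apply/andP; split; nra.
split; apply: (le_integrable measurableT _ _ (integrableD measurableT if_ ig)).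
- exact/measurable_EFinP.
- move=> x _ /=; rewrite lee_fin !normc_sqr; case: (f x) (g x) => [a b] [c e] /=.
  apply: le_trans (ler_norm _).
  by have [] := bound a b c e.
- exact/measurable_EFinP.
- move=> x _ /=; rewrite lee_fin !normc_sqr; case: (f x) (g x) => [a b] [c e] /=.
  apply: le_trans (ler_norm _).
  by have [] := bound a b c e.
Qed.

End ComplexIntegral.

(** * Matrix multiplication on vector-valued L2 *)

Section L2Theory.
Variables (R : realType) (n : nat).
Local Notation m := (@circle_measure R).
Local Notation L2 := (L2 R n).
Local Notation H2 := (H2 R n).
Implicit Types (F G K : L2) (Phi Psi : circle R -> 'M[R[i]]_n).
Implicit Types (A B : 'M[R[i]]_n).

(** Representatives satisfy algebraic identities only almost everywhere, so
    equalities in L2 are obtained from almost everywhere equalities of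
    representatives. *)
Lemma L2ext F G : (\forall z \ae m, L2rep F z = L2rep G z) -> F = G.
Proof. by move=> FG; rewrite -[F]L2repK -[G]L2repK; apply/eqP/L2classP. Qed.

Lemma L2rep_linear (a : R[i]) F G :
  \forall z \ae m, L2rep (a *: F + G) z = a *: L2rep F z + L2rep G z.
Proof.
have -> : a *: F + G = L2class (a *: L2rep F + L2rep G).
  by rewrite L2class_add L2class_scale !L2repK.
by apply: filterS (L2classK (a *: L2rep F + L2rep G)) => z ->.
Qed.

Lemma L2rep_cmeasurable F i : cmeasurable (fun z => L2rep F z i 0).
Proof. by case: (sqr_integrable_L2fun (L2rep F) i). Qed.

Lemma normc_ge0 (x : R[i]) : 0 <= Normc.normc x.
Proof. by case: x => a b; exact: sqrtr_ge0. Qed.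

Lemma normc_sum (I : finType) (f : I -> R[i]) :
  Normc.normc (\sum_i f i) <= \sum_i Normc.normc (f i).
Proof.
apply: (big_ind2 (fun x y => Normc.normc x <= y)) => //.
  by rewrite Normc.normc0.
by move=> x1 y1 x2 y2 h1 h2; apply: le_trans (le_normcD _ _) (lerD h1 h2).
Qed.

Lemma Linfty_cst A : Linfty (fun=> A).
Proof.
split=> [i j|]; first exact: cmeasurable_cst.
exists (\sum_i \sum_j Normc.normc (A i j)); apply: nearW => _ i j.
have ge0 k : 0 <= \sum_j Normc.normc (A k j).
  by apply: sumr_ge0 => l _; exact: normc_ge0.
rewrite (bigD1 i)//= (bigD1 j)//= -addrA lerDl addr_ge0 ?sumr_ge0//.
by move=> l _; exact: normc_ge0.
Qed.

Lemma Linfty_mul Phi Psi :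
  Linfty Phi -> Linfty Psi -> Linfty (fun z => Phi z *m Psi z).
Proof.
move=> [mPhi [M PhiM]] [mPsi [N PsiN]]; split=> [i j|].
  under eq_fun do rewrite mxE.
  by apply: cmeasurable_sum => k; exact: cmeasurableM.
exists (\sum_(k < n) M * N); apply: filterS2 PhiM PsiN => z zM zN i j.
rewrite mxE; apply: le_trans (normc_sum _) _; apply: ler_sum => k _.
by rewrite Normc.normcM ler_pM// normc_ge0.
Qed.

Lemma L2mul_linear Phi : Linfty Phi -> linear (@L2mul R n Phi).
Proof.
move=> PhiP a F G; apply: L2ext.
have h1 := L2mulE (a *: F + G) PhiP; have h2 := L2rep_linear a F G.
have h3 := L2rep_linear a (L2mul Phi F) (L2mul Phi G).
have h4 := L2mulE F PhiP; have h5 := L2mulE G PhiP.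
apply: filterS2 (filterI h1 h2) (filterI h3 (filterI h4 h5)).
move=> z [e1 e2] [e3 [e4 e5]].
rewrite [LHS]e1 [in LHS]e2 [RHS]e3 [X in _ = _ *: X + _]e4 [X in _ = _ + X]e5.
by rewrite mulmxDr scalemxAr.
Qed.

Lemma L2mulM Phi Psi F : Linfty Phi -> Linfty Psi ->
  L2mul Phi (L2mul Psi F) = L2mul (fun z => Phi z *m Psi z) F.
Proof.
move=> PhiP PsiP; apply: L2ext.
have h1 := L2mulE (L2mul Psi F) PhiP; have h2 := L2mulE F PsiP.
have h3 := L2mulE F (Linfty_mul PhiP PsiP).
apply: filterS2 (filterI h1 h2) h3 => z [e1 e2] e3.
by rewrite [LHS]e1 [X in _ *m X]e2 [RHS]e3 mulmxA.
Qed.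

Lemma L2mul1 F : L2mul (fun=> 1%:M) F = F.
Proof.
apply: L2ext; apply: filterS (L2mulE F (Linfty_cst 1%:M)) => z ->.
by rewrite mul1mx.
Qed.

(** * The inner product of L2 *)

Lemma cV_dot_cmeasurable F G :
  cmeasurable (fun z => cV_dot (L2rep F z) (L2rep G z)).
Proof.
apply: cmeasurable_sum => i.
by apply: cmeasurableM; [|apply: cmeasurable_conj]; exact: L2rep_cmeasurable.
Qed.

Lemma cV_dot_cintegrable F G :
  cintegrable m (fun z => cV_dot (L2rep F z) (L2rep G z)).
Proof.
apply: cintegrable_sum => i.
by apply: cintegrable_mul_conj; exact: sqr_integrable_L2fun.
Qed.

Lemma L2dot_linear (a : R[i]) F G K :
  L2dot (a *: F + G) K = a * L2dot F K + L2dot G K.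
Proof.
have FK := cV_dot_cintegrable F K; have GK := cV_dot_cintegrable G K.
rewrite -(cintegralZl _ FK) -(cintegralD (cintegrableZl _ FK) GK).
apply: eq_ae_cintegral.
- exact: cV_dot_cmeasurable.
- apply: cmeasurableD; last exact: cV_dot_cmeasurable.
  by apply: cmeasurableM; [exact: cmeasurable_cst|exact: cV_dot_cmeasurable].
- apply: filterS (L2rep_linear a F G) => z ->.
  rewrite /cV_dot mulr_sumr -big_split /=; apply: eq_bigr => i _.
  by rewrite !mxE mulrDl mulrA.
Qed.

Lemma L2dotB F G K : L2dot (F - G) K = L2dot F K - L2dot G K.
Proof. by rewrite addrC -scaleN1r L2dot_linear mulN1r addrC. Qed.

Lemma cV_dot_adj A (v w : 'cV[R[i]]_n) :
  cV_dot (A *m v) w = cV_dot v (A ^t* *m w).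
Proof.
rewrite /cV_dot; under eq_bigr do rewrite mxE mulr_suml.
rewrite exchange_big; apply: eq_bigr => j _ /=.
rewrite mxE rmorph_sum mulr_sumr; apply: eq_bigr => i _ /=.
by rewrite !mxE rmorphM /= conjCK mulrCA mulrA.
Qed.

Lemma L2dot_adj A F G :
  L2dot (L2mul (fun=> A) F) G = L2dot F (L2mul (fun=> A ^t*) G).
Proof.
apply: eq_ae_cintegral; try exact: cV_dot_cmeasurable.
have hF := L2mulE F (Linfty_cst A); have hG := L2mulE G (Linfty_cst (A ^t*)).
apply: filterS2 hF hG => z eF eG.
by rewrite [X in cV_dot X _]eF [X in _ = cV_dot _ X]eG; exact: cV_dot_adj.
Qed.

(** The real part of the inner product of F with itself is the integral of the
    nonnegative function |F|^2, which vanishes only if F does so almost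
    everywhere. *)
Lemma L2dot_eq0 F : L2dot F F = 0 -> F = 0.
Proof.
have dotE (v : 'cV[R[i]]_n) : complex.Re (cV_dot v v) = cV_sqnorm v.
  rewrite /cV_dot /cV_sqnorm raddf_sum; apply: eq_bigr => i _ /=.
  by rewrite normc_sqr; case: (v i 0) => a b /=; ring.
have sq0 (v : 'cV[R[i]]_n) : 0 <= cV_sqnorm v.
  by apply: sumr_ge0 => i _; exact: sqr_ge0.
have [int_dot _] := cV_dot_cintegrable F F.
move=> [+ _]; under eq_Rintegral do rewrite dotE.
move=> dot0.
have int_sq : m.-integrable setT (fun z => (cV_sqnorm (L2rep F z))%:E).
  by apply: eq_integrable int_dot => // z _; rewrite dotE.
have /integrableP[msq _] := int_sq.
have : (\int[m]_z `|(cV_sqnorm (L2rep F z))%:E|)%E = 0%E.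
  under eq_integral do rewrite gee0_abs ?lee_fin//.
  rewrite -[LHS]fineK; last exact: integrable_fin_num.
  by congr EFin.
move=> /(ae_eq_integral_abs m measurableT msq) ae0.
have {}ae0 : \forall z \ae m, L2rep F z = 0.
  apply: filterS ae0 => z /(_ I) [] /eqP; rewrite psumr_eq0; last first.
    by move=> i _; exact: sqr_ge0.
  move=> /allP h; apply/colP => i; rewrite mxE.
  have := h i (mem_index_enum _); rewrite /= sqrf_eq0 => /eqP.
  exact: Normc.eq0_normc.
(* The representative of 0 is itself only almost everywhere 0, so F is compared
   with the sum -F + F. *)
have -> : F = (-1) *: F + F.
  apply: L2ext; apply: filterS2 ae0 (L2rep_linear (-1) F F) => z F0 ->.
  by rewrite F0 scaler0 addr0.
by rewrite scaleN1r addNr.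
Qed.

(** * Constant matrices and the Hardy space *)

(** The i-th coordinate of A F is a linear combination of those of F with
    constant coefficients, and the integral is linear. *)
Lemma fourier_coef_mul A F k : k < 0 ->
  fourier_coef (L2mul (fun=> A) F) k = A *m fourier_coef F k.
Proof.
case: k => // k _; apply/colP => i; rewrite !mxE NegzE opprK /=.
(* The factor z ^ k.+1 has modulus 1, so square integrability is preserved. *)
have int_F j : cintegrable m (fun z => L2rep F z j 0 * val z ^ k.+1).
  apply: sqr_integrable_cintegrable.
  under eq_fun do rewrite mulrC; apply: (@sqr_integrable_bddM _ _ _ _ 1).
  - exact: cmeasurable_circleX.
  - apply: nearW => z.
    elim: k.+1 => [|l IH]; first by rewrite expr0z Normc.normc1.
    by rewrite exprSz Normc.normcM normc_circle mul1r.
  - exact: sqr_integrable_L2fun.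
have intA j := cintegrableZl (A i j) (int_F j).
transitivity (cintegral m (fun z =>
    \sum_j A i j * (L2rep F z j 0 * val z ^ k.+1))).
  have mX := @cmeasurable_circleX R k.+1.
  apply: eq_ae_cintegral.
  - by apply: cmeasurableM => //; exact: L2rep_cmeasurable.
  - apply: cmeasurable_sum => j; apply: cmeasurableM; first exact: cmeasurable_cst.
    by apply: cmeasurableM => //; exact: L2rep_cmeasurable.
  - apply: filterS (L2mulE F (Linfty_cst A)) => z ->.
    by rewrite mxE mulr_suml; apply: eq_bigr => j _; rewrite mulrA.
rewrite cintegral_sum//; apply: eq_bigr => j _.
by rewrite cintegralZl// mxE opprK.
Qed.

Lemma H2_mul_cst A (f : H2) : L2mul (fun=> A) f \in @H2pred R n.
Proof.
apply/asboolP => k k0; rewrite fourier_coef_mul//.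
by case: f => f /= /asboolP ->//; rewrite mulmx0.
Qed.

Definition H2mul A (f : H2) : H2 := MkH2 (H2_mul_cst A f).

Lemma H2mul_linear A : linear (H2mul A).
Proof.
by move=> a f g; apply: val_inj; exact: (L2mul_linear (Linfty_cst A)).
Qed.

Lemma H2mulM A B f : H2mul A (H2mul B f) = H2mul (A *m B) f.
Proof.
by apply: val_inj; exact: (L2mulM _ (Linfty_cst A) (Linfty_cst B)).
Qed.

Lemma H2mul1 f : H2mul 1%:M f = f.
Proof. by apply: val_inj; exact: L2mul1. Qed.

Lemma H2mul_unitary A :
  A ^t* *m A = 1%:M -> unitary_operator (@H2dot R n) (H2mul A) (H2mul (A ^t*)).
Proof.
move=> AA; have adj : is_adjoint (@H2dot R n) (H2mul A) (H2mul (A ^t*)).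
  by move=> f g; exact: L2dot_adj.
have KA f : H2mul (A ^t*) (H2mul A f) = f by rewrite H2mulM AA H2mul1.
split=> //; last by move=> f /=; rewrite H2mulM (mulmx1C AA) H2mul1.
split; first exact: H2mul_linear.
by exists 1 => f; rewrite mul1r /ip_norm adj KA.
Qed.

(** The defining property of the Hardy projection g of F, kept as a relation so
    that it can be transported along matrices whether or not g exists. *)
Definition is_hardy_proj F (g : H2) :=
  forall h : H2, L2dot (F - H2val g) h = 0.

(** The difference of two projections of F lies in H2 and is orthogonal to H2,
    hence to itself. *)
Lemma is_hardy_proj_unique F g g' :
  is_hardy_proj F g -> is_hardy_proj F g' -> g = g'.
Proof.
move=> gP g'P; apply/val_inj/eqP; rewrite -subr_eq0; apply/eqP/L2dot_eq0.
rewrite -[X in L2dot _ X]/(val (g - g')).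
have -> : val g - val g' = F - val g' - (F - val g).
  by rewrite opprB [RHS]addrC addrA subrK.
by rewrite L2dotB gP g'P subrr.
Qed.

(** The inner product of A (F - g) with h is that of F - g with A^* h, and A^* h
    is again in H2. *)
Lemma is_hardy_proj_mul A F g :
  is_hardy_proj F g -> is_hardy_proj (L2mul (fun=> A) F) (H2mul A g).
Proof.
move=> gP h; have lin := L2mul_linear (Linfty_cst A).
have -> : L2mul (fun=> A) F - H2val (H2mul A g) = L2mul (fun=> A) (F - val g).
  by rewrite addrC -scaleN1r -lin scaleN1r addrC.
by rewrite L2dot_adj; exact: (gP (H2mul (A ^t*) h)).
Qed.

Lemma hardy_proj_mul A F : A ^t* *m A = 1%:M ->
  hardy_proj (L2mul (fun=> A) F) = H2mul A (hardy_proj F).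
Proof.
move=> AA; have [[g gP]|noproj] := pselect (exists g, is_hardy_proj F g).
  rewrite /hardy_proj (xget_unique _ gP); last first.
    by move=> g' g'P; exact: is_hardy_proj_unique gP.
  have AgP := is_hardy_proj_mul A gP.
  by rewrite (xget_unique _ AgP)// => g' g'P; exact: is_hardy_proj_unique AgP.
(* A projection of A F would give the projection A^* g of A^* A F = F, so both
   sides are built from the default value 0. *)
rewrite /hardy_proj !xgetPN; last first.
- move=> g gP; apply: noproj; exists (H2mul (A ^t*) g).
  have := is_hardy_proj_mul (A ^t*) gP.
  by rewrite L2mulM ?AA ?L2mul1//; exact: Linfty_cst.
- by move=> g gP; apply: noproj; exists g.
by have := H2mul_linear A (-1) 0 0; rewrite scaler0 addr0 scaleN1r addNr.
Qed.

(** * Unitary equivalence of Toeplitz operators *)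

(** With V the action of A^*, the matrix identity Phi = A Psi A^* and the
    commutation of A with the projection give T_Phi = V^* T_Psi V. *)
Lemma toeplitz_unitarily_equivalent A Phi Psi : A ^t* *m A = 1%:M ->
  Linfty Phi -> (forall z, A ^t* *m Phi z *m A = Psi z) ->
  unitarily_equivalent (@H2dot R n) (toeplitz Phi) (toeplitz Psi).
Proof.
move=> AA PhiP PsiE; have AA' := mulmx1C AA.
have PsiP : Linfty Psi.
  have -> : Psi = fun z => A ^t* *m Phi z *m A by apply/funext => z; rewrite PsiE.
  by apply: Linfty_mul (Linfty_cst A); exact: Linfty_mul (Linfty_cst _) PhiP.
have uA := unitary_operator_sym (H2mul_unitary AA).
exists (H2mul (A ^t*)), (H2mul A); split; first exact: uA.
move=> f; have cA := Linfty_cst A; have cAt := Linfty_cst (A ^t*).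
have mulE : L2mul Phi f =
    L2mul (fun=> A) (L2mul Psi (L2mul (fun=> A ^t*) f)).
  rewrite [X in L2mul (fun=> A) X](L2mulM f PsiP cAt).
  rewrite (L2mulM f cA (Linfty_mul PsiP cAt)).
  congr (L2mul _ _); apply/funext => z.
  by rewrite -PsiE !mulmxA AA' mul1mx -mulmxA AA' mulmx1.
exact: etrans (congr1 _ mulE) (hardy_proj_mul _ AA).
Qed.

End L2Theory.

Theorem theorem3p5 (R : realType) (n : nat) (n_gt0 : (0 < n)%N)
    (phi : 'I_n -> circle R -> R[i])
    (Phi_Linfty : Linfty (fun z => circ (phi ^~ z))) :
  let Phi := fun z => circ (phi ^~ z) in
  let U := dft_mx R n in
  let lambda := fun (k : 'I_n) z =>
    \sum_(j < n) phi j z * mu_root R n ^+ (j * k) in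
  let Lambda := fun z => diag_mx (\row_k lambda k z) in
  [/\ U \is unitarymx,
      forall z, U ^t* *m Phi z *m U = Lambda z,
      unitarily_equivalent (@H2dot R n) (toeplitz Phi) (toeplitz Lambda) &
      binormal (@H2dot R n) (toeplitz Phi) <->
      binormal (@H2dot R n) (toeplitz Lambda)].
Proof.
move=> Phi U lambda Lambda.
have UU : U ^t* *m U = 1%:M := dft_mx_unitary R n_gt0.
have diagE z : U ^t* *m Phi z *m U = Lambda z by exact: circ_dft_diag.
have ue := toeplitz_unitarily_equivalent UU Phi_Linfty diagE.
split; [exact/unitarymxP/mulmx1C|exact: diagE|exact: ue|].
split; last exact: binormal_unitarily_equivalent.
exact/binormal_unitarily_equivalent/unitarily_equivalent_sym.
Qed.
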